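(* Let $\mathcal A(M_T)$ be a GLP algebra of rank $n$ pointed at $t_0\in T$. If $\mathcal A(M_T)$ is positive, then: (i) different cluster monomials of $\mathcal A(M_T)$ have different $\mathbf g$-vectors (with respect to $X_{t_0}$); (ii) for every $t\in T$, the $\mathbf g$-vectors $\mathbf g_{1;t}^{t_0},\dots,\mathbf g_{n;t}^{t_0}$ form a $\mathbb Z$-basis of $\mathbb Z^n$.
   Context: Let $\mathbb P$ be a (multiplicative) abelian group whose group ring $\mathbb{ZP}$ is a domain, and let $\mathcal F$ be the field of rational functions in $n$ independent variables with coefficients in $\mathbb{ZP}$. $\mathbb N$ denotes the nonnegative integers. A cluster in $\mathcal F$ is $X_t=\{x_{1;t},\dots,x_{n;t}\}$ such that $x_{1;t},\dots,x_{n;t}$ form a free generating set of $\mathcal F$ (over the fraction field of $\mathbb{ZP}$); its elements are called cluster variables. For an index set $T$, a family of clusters $M_T=\{X_t\mid t\in T\}$ in $\mathcal F$ is a GLP (generalized Laurent phenomenon) pattern of rank $n$ if $X_{t'}\subseteq\mathbb{ZP}[x_{1;t}^{\pm1},\dots,x_{n;t}^{\pm1}]$ for all $t,t'\in T$. The GLP algebra $\mathcal A(M_T)$ is the $\mathbb{ZP}$-subalgebra of $\mathcal F$ generated by all cluster variables of $M_T$. Let $m\ge 0$ and let $y_1,\dots,y_m\in\mathbb P$ be such that $x_{1;t},\dots,x_{n;t},y_1,\dots,y_m$ are algebraically independent over $\mathbb Z$. Put $\mathcal L_p(t)=\mathbb Z[y_1,\dots,y_m][x_{1;t}^{\pm1},\dots,x_{n;t}^{\pm1}]$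 and $\mathcal L_p^+(t)=\mathbb Z_{\ge0}[y_1,\dots,y_m][x_{1;t}^{\pm1},\dots,x_{n;t}^{\pm1}]$. Write $\mathbf x_t^{\mathbf a}=\prod_{i=1}^n x_{i;t}^{a_i}$ for $\mathbf a\in\mathbb Z^n$ and $\mathbf y^{\mathbf v}=\prod_{i=1}^m y_i^{v_i}$ for $\mathbf v\in\mathbb N^m$. $\mathcal A(M_T)$ is of geometric type if $X_{t'}\subseteq\mathcal L_p(t)$ for all $t,t'\in T$. It is pointed at $t_0\in T$ if it is of geometric type and every cluster variable $x_{i;t}$ of $M_T$ has the form (finite sum) $$x_{i;t}=\mathbf x_{t_0}^{\mathbf g_{i;t}^{t_0}}\Bigl(1+\sum_{0\ne\mathbf v\in\mathbb N^m,\ \mathbf u\in\mathbb Z^n}c_{\mathbf v,\mathbf u}\,\mathbf y^{\mathbf v}\mathbf x_{t_0}^{\mathbf u}\Bigr),\qquad c_{\mathbf v,\mathbf u}\in\mathbb Z,$$ with $\mathbf g_{i;t}^{t_0}\in\mathbb Z^n$, called the $\mathbf g$-vector of $x_{i;t}$ with respect to $X_{t_0}$. The $G$-matrix is $G_t^{t_0}=(\mathbf g_{1;t}^{t_0},\dots,\mathbf g_{n;t}^{t_0})\in M_n(\mathbb Z)$ (columns are $\mathbf g$-vectors). A cluster monomial is an element $\mathbf x_t^{\mathbf a}$ of $\mathcal F$ with $t\in T$, $\mathbf a\in\mathbb N^n$; its $\mathbf g$-vector with respect to $X_{t_0}$ is $G_t^{t_0}\mathbf a$. A GLP algebra pointed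 at $t_0$ is positive if $X_{t'}\subseteq\mathcal L_p^+(t)$ for all $t,t'\in T$. *)

(* Defs.v *)
From HB Require Import structures.
From mathcomp Require Import all_boot all_order all_algebra.
From mathcomp Require Import mpoly.

Set Implicit Arguments.
Unset Strict Implicit.
Unset Printing Implicit Defensive.

Import Order.TTheory GRing.Theory Num.Theory.
Local Open Scope ring_scope.

(* MathComp has no group rings of infinite groups. [is_group_ring e] says that
   the ring A is the group ring Z[P], e : P -> A being the canonical inclusion:
   the image of e is a Z-basis of A, on which the product is that of P. *)
Definition is_group_ring (P : groupType) (A : nzRingType) (e : P -> A) : Prop :=
  [/\ e 1%g = 1,
      forall p q : P, e (p * q)%g = e p * e q,
      forall (s : seq P) (c : P -> int), uniq s ->
        \sum_(p <- s) (c p)%:~R * e p = 0 -> forall p, p \in s -> c p = 0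
    & forall a : A, exists (s : seq P) (c : P -> int),
        a = \sum_(p <- s) (c p)%:~R * e p].

(* The coefficients "in A" of the rational functions in n variables make up
   the fraction field of A. *)
Definition ratfun (A : idomainType) (n : nat) : fieldType :=
  {fraction {mpoly {fraction A}[n]}}.

Section Embeddings.
Variables (A : idomainType) (n : nat).

Definition const_ratfun : {fraction A} -> ratfun A n :=
  @tofrac {mpoly {fraction A}[n]} \o @mpolyC n {fraction A}.

HB.instance Definition _ := GRing.RMorphism.copy const_ratfun
  (@tofrac {mpoly {fraction A}[n]} \o @mpolyC n {fraction A}).

Definition ground_ratfun : A -> ratfun A n := const_ratfun \o @tofrac A.

HB.instance Definition _ := GRing.RMorphism.copy ground_ratfun
  (const_ratfun \o @tofrac A).

End Embeddings.

Section FreeGeneration.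
Variables (R : nzRingType) (F : fieldType) (iota : R -> F).
Variable (n : nat).

Definition alg_indep (x : 'I_n -> F) : Prop :=
  forall p : {mpoly R[n]}, mmap iota x p = 0 -> p = 0.

Definition generates_field (x : 'I_n -> F) : Prop :=
  forall z : F, exists p q : {mpoly R[n]},
    mmap iota x q != 0 /\ z = mmap iota x p / mmap iota x q.

Definition free_generating (x : 'I_n -> F) : Prop :=
  alg_indep x /\ generates_field x.

End FreeGeneration.

Section Laurent.
Variables (F : fieldType) (n : nat).

Definition monom (x : 'I_n -> F) (a : 'cV[int]_n) : F :=
  \prod_(i < n) x i ^ a i ord0.

(* C[x_1^{+-1}, ..., x_n^{+-1}] as a subset of F, for a set C of coefficients *)
Definition laurent (C : F -> Prop) (x : 'I_n -> F) (z : F) : Prop :=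
  exists (N : nat) (c : 'I_N -> F) (u : 'I_N -> 'cV[int]_n),
    (forall k, C (c k)) /\ z = \sum_(k < N) c k * monom x (u k).

Variable (m : nat).

Definition polyZ (y : 'I_m -> F) (c : F) : Prop :=
  exists p : {mpoly int[m]}, c = mmap intr y p.

Definition polyZ_nneg (y : 'I_m -> F) (c : F) : Prop :=
  exists p : {mpoly int[m]},
    (forall v : 'X_{1..m}, 0 <= p@_v) /\ c = mmap intr y p.

(* the family x_1, ..., x_n, y_1, ..., y_m *)
Definition join_family (x : 'I_n -> F) (y : 'I_m -> F) : 'I_(n + m) -> F :=
  fun k => match split k with inl i => x i | inr j => y j end.

Definition has_gvector (x : 'I_n -> F) (y : 'I_m -> F) (z : F)
    (g : 'cV[int]_n) : Prop :=
  exists (N : nat) (c : 'I_N -> int) (v : 'I_N -> 'X_{1..m})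
         (u : 'I_N -> 'cV[int]_n),
    (forall k, v k != 0%MM) /\
    z = monom x g *
        (1 + \sum_(k < N) (c k)%:~R * (\prod_(j < m) y j ^+ v k j)
                                    * monom x (u k)).

End Laurent.

(* A family of (labelled) clusters is x : T -> 'I_n -> ratfun A n; in the
   definitions below, A plays the role of the group ring. *)
Section Patterns.
Variables (A : idomainType) (n : nat) (T : Type).
Variable (x : T -> 'I_n -> ratfun A n).

Definition GLP_pattern : Prop :=
  (forall t, free_generating (@const_ratfun A n) (x t)) /\
  (forall t t' i,
     laurent (fun c => exists a : A, c = ground_ratfun n a) (x t) (x t' i)).

Variables (m : nat) (y : 'I_m -> ratfun A n).

Definition geometric_type : Prop :=
  forall t t' i, laurent (polyZ y) (x t) (x t' i).

Definition pointed (t0 : T) : Prop :=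
  geometric_type /\ forall t i, exists g, has_gvector (x t0) y (x t i) g.

Definition positive : Prop :=
  forall t t' i, laurent (polyZ_nneg y) (x t) (x t' i).

Definition is_Gmatrix (t0 t : T) (G : 'M[int]_n) : Prop :=
  forall i, has_gvector (x t0) y (x t i) (col i G).

Definition cluster_monomial (t : T) (a : 'cV[nat]_n) : ratfun A n :=
  monom (x t) (map_mx Posz a).

End Patterns.

Definition is_Zbasis (n : nat) (b : 'I_n -> 'cV[int]_n) : Prop :=
  (forall c : 'I_n -> int, \sum_(i < n) c i *: b i = 0 -> forall i, c i = 0) /\
  (forall v : 'cV[int]_n, exists c : 'I_n -> int, v = \sum_(i < n) c i *: b i).

(* Main.v *)
Require Import Defs.
From HB Require Import structures.
From mathcomp Require Import all_boot all_order all_algebra.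
From mathcomp Require Import mpoly.

Set Implicit Arguments.
Unset Strict Implicit.
Unset Printing Implicit Defensive.

Import Order.TTheory GRing.Theory Num.Theory.
Local Open Scope ring_scope.

(** The proof compares two ways of looking at an element of the field: its
    value at y = 0, and its sign as a subtraction-free expression.

    Since x_{t0} and y are algebraically independent, putting y = 0 is a
    well-defined partial operation on the field ([specializes_fun]); it is
    compatible with sums, products and inverses of elements whose value is not
    zero.  A g-vector is precisely the exponent of the value at y = 0: x_{i;t}
    goes to the monomial of x_{t0} with exponent g_{i;t}, hence x_t^u goes to
    x_{t0}^{G_t u} for every integral u.

    Let f be an element whose value at y = 0 is x_{t0}^b and which is a Laurent
    polynomial in x_t with coefficients in Z>=0[y].  At y = 0 its expansion
    sum_k p_k(y) x_t^{u_k} becomes sum_k p_k(0) x_{t0}^{G_t u_k} = x_{t0}^b, so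
    some k has G_t u_k = b and p_k(0) > 0.  Therefore the monomial x_t^{u_k} can
    be subtracted from f without leaving the Laurent polynomials with
    coefficients in Z>=0[y] ([leading_term_split]).

    For f = x_{j;t0} this gives G_t u = e_j for some integral u.  As this holds
    for every j, G_t is invertible over Z, which is (ii).

    For f = x_t^a with G_t a = G_{t'} a', expanded in x_{t'}, the exponent u is
    a' because G_{t'} is invertible.  Hence x_t^a - x_{t'}^{a'} is a Laurent
    polynomial in x_{t'} with coefficients in Z>=0[y].  The x_{i;t'} are
    themselves quotients of polynomials in x_{t0} and y with nonnegative
    coefficients, so that the difference is such a quotient
    ([cluster_monomial_diff_subtraction_free]).  Exchanging the two monomials,
    so is its opposite; and zero is the only quotient of this kind whose opposite
    is one too ([subtraction_free_antisym]).  So the two monomials are equal,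
    which is (i). *)

(** * Specialization of fractions *)

Section Specialization.
Variables (R : idomainType) (F : fieldType).
Variables (phi : {rmorphism R -> F}) (pi : {rmorphism R -> R}).
Hypothesis phi_inj : forall p, phi p = 0 -> p = 0.

(** The place of the fraction field of R attached to the prime ideal [ker pi]:
    z is in the local ring at this ideal, and w is its residue.  A relation avoids
    choosing a numerator and a denominator. *)
Definition specializes (z w : F) : Prop :=
  exists p q : R, [/\ pi q != 0, z = phi p / phi q & w = phi (pi p) / phi (pi q)].

Let phi_neq0 p : p != 0 -> phi p != 0.
Proof. by apply: contra_neq => /phi_inj. Qed.

Let phi_pi_neq0 q : pi q != 0 -> phi q != 0 /\ phi (pi q) != 0.
Proof.
move=> piq; split; apply: phi_neq0 => //.
by apply: contraNneq piq => ->; rewrite rmorph0.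
Qed.

(** By cross-multiplication, which [phi] reflects to an equation in R, to which
    [pi] applies. *)
Lemma specializes_fun z w w' : specializes z w -> specializes z w' -> w = w'.
Proof.
case=> p [q [q0 -> ->]] [p' [q' [q0' e ->]]].
have [fq fpq] := phi_pi_neq0 q0; have [fq' fpq'] := phi_pi_neq0 q0'.
have /phi_inj/eqP: phi (p * q' - p' * q) = 0.
  move/eqP: e; rewrite eqr_div // => /eqP e.
  by rewrite rmorphB !rmorphM /= e subrr.
rewrite subr_eq0 => /eqP e'.
by apply/eqP; rewrite eqr_div // -!rmorphM e'.
Qed.

Lemma specializes_eval p : specializes (phi p) (phi (pi p)).
Proof. by exists p, 1; rewrite !rmorph1 oner_neq0 !divr1. Qed.

Lemma specializesD z w z' w' :
  specializes z w -> specializes z' w' -> specializes (z + z') (w + w').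
Proof.
case=> p [q [q0 -> ->]] [p' [q' [q0' -> ->]]].
have [fq fpq] := phi_pi_neq0 q0; have [fq' fpq'] := phi_pi_neq0 q0'.
exists (p * q' + p' * q), (q * q').
by rewrite !addf_div // !rmorphD !rmorphM /= mulf_neq0.
Qed.

Lemma specializesM z w z' w' :
  specializes z w -> specializes z' w' -> specializes (z * z') (w * w').
Proof.
case=> p [q [q0 -> ->]] [p' [q' [q0' -> ->]]].
exists (p * p'), (q * q').
by rewrite !mulf_div !rmorphM /= mulf_neq0.
Qed.

(** A nonzero residue means that the numerator is outside [ker pi], so that it
    is allowed as a denominator. *)
Lemma specializesV z w : w != 0 -> specializes z w -> specializes z^-1 w^-1.
Proof.
move=> w0 [p [q [q0 -> ew]]]; exists q, p; rewrite ew !invf_div.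
split=> //; apply: contraNneq w0 => pip.
by rewrite ew pip rmorph0 mul0r.
Qed.

Lemma specializes_nat k : specializes k%:R k%:R.
Proof.
by rewrite -(rmorph_nat phi) -{2}(rmorph_nat pi); apply: specializes_eval.
Qed.

Lemma specializes_int (c : int) : specializes c%:~R c%:~R.
Proof.
by rewrite -(rmorph_int phi) -{2}(rmorph_int pi); apply: specializes_eval.
Qed.

Lemma specializes_sum (I : Type) (r : seq I) (f g : I -> F) :
  (forall i, specializes (f i) (g i)) ->
  specializes (\sum_(i <- r) f i) (\sum_(i <- r) g i).
Proof.
move=> fg; apply: big_ind2 => //; [exact: (specializes_nat 0)|].
by move=> *; apply: specializesD.
Qed.

Lemma specializes_prod (I : Type) (r : seq I) (f g : I -> F) :
  (forall i, specializes (f i) (g i)) ->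
  specializes (\prod_(i <- r) f i) (\prod_(i <- r) g i).
Proof.
move=> fg; apply: big_ind2 => //; [exact: (specializes_nat 1)|].
by move=> *; apply: specializesM.
Qed.

Lemma specializesX z w k : specializes z w -> specializes (z ^+ k) (w ^+ k).
Proof.
move=> zw; elim: k => [|k IH]; first exact: (specializes_nat 1).
by rewrite !exprS; apply: specializesM.
Qed.

Lemma specializes_expz z w (k : int) :
  w != 0 -> specializes z w -> specializes (z ^ k) (w ^ k).
Proof.
move=> w0 zw; case: k => k /=; first exact: specializesX.
by rewrite NegzE -!exprz_inv; apply/specializesX/specializesV.
Qed.

Lemma specializes_monom n (z w : 'I_n -> F) (a : 'cV[int]_n) :
  (forall i, w i != 0) -> (forall i, specializes (z i) (w i)) ->
  specializes (monom z a) (monom w a).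
Proof.
by move=> w0 zw; apply: specializes_prod => i; apply: specializes_expz.
Qed.

End Specialization.

(** * Laurent monomials *)

Section Monomials.
Variables (F : fieldType) (n : nat) (x : 'I_n -> F).
Hypothesis x_neq0 : forall i, x i != 0.

Lemma monom0 : monom x 0 = 1.
Proof. by apply: big1 => i _; rewrite mxE. Qed.

Lemma monomD a b : monom x (a + b) = monom x a * monom x b.
Proof.
by rewrite /monom -big_split; apply: eq_bigr => i _; rewrite mxE expfzDr.
Qed.

Lemma monom_neq0 a : monom x a != 0.
Proof. by apply/prodf_neq0 => i _; apply: expfz_neq0. Qed.

Lemma monom_delta i : monom x (delta_mx i 0) = x i.
Proof.
rewrite /monom (bigD1 i) //= mxE !eqxx big1 ?mulr1 // => j /negPf ji.
by rewrite mxE ji.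
Qed.

Lemma monom_expz a (k : int) : monom x (k *: a) = monom x a ^ k.
Proof.
rewrite /monom.
rewrite (big_morph (fun z => z ^ k) (fun z z' => expfzMl z z' k) (exp1rz _ k)).
by apply: eq_bigr => i _; rewrite mxE exprz_exp mulrC.
Qed.

Lemma monom_sum (I : Type) (r : seq I) (a : I -> 'cV[int]_n) :
  monom x (\sum_(i <- r) a i) = \prod_(i <- r) monom x (a i).
Proof. by apply: big_morph; [exact: monomD | exact: monom0]. Qed.

(** This is how a G-matrix acts on exponents: the y = 0 part of a Laurent
    monomial in x_t is obtained by multiplying its exponent by G_t. *)
Lemma monom_mulmx r (G : 'M[int]_(n, r)) (u : 'cV[int]_r) :
  monom (fun j => monom x (col j G)) u = monom x (G *m u).
Proof.
have -> : G *m u = \sum_j u j 0 *: col j G.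
  apply/matrixP => i k; rewrite !ord1 mxE summxE.
  by apply: eq_bigr => j _; rewrite !mxE mulrC.
by rewrite monom_sum; apply: eq_bigr => j _; rewrite monom_expz.
Qed.

End Monomials.

Section LaurentRing.
Variables (F : fieldType) (n : nat) (x : 'I_n -> F).
Hypothesis x_neq0 : forall i, x i != 0.
Variable C : F -> Prop.
Hypothesis C1 : C 1.
Hypothesis CM : forall a b, C a -> C b -> C (a * b).

Lemma laurent_fin (I : finType) (c : I -> F) (u : I -> 'cV[int]_n) :
  (forall i, C (c i)) -> laurent C x (\sum_i c i * monom x (u i)).
Proof.
move=> Cc; exists #|I|, (c \o enum_val), (u \o enum_val).
split=> [k|]; first exact: Cc.
by rewrite [LHS](big_enum_val (A := I)).
Qed.

Lemma laurent1 : laurent C x 1.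
Proof.
have := @laurent_fin 'I_1 (fun=> 1) (fun=> 0) (fun=> C1).
by rewrite big_ord1 monom0 mulr1.
Qed.

Lemma laurentM z z' : laurent C x z -> laurent C x z' -> laurent C x (z * z').
Proof.
case=> N [c [u [Cc ->]]] [N' [c' [u' [Cc' ->]]]].
rewrite big_distrlr /= pair_big /=.
have := @laurent_fin ('I_N * 'I_N')%type (fun p => c p.1 * c' p.2)
   (fun p => u p.1 + u' p.2) (fun p => CM (Cc _) (Cc' _)).
by congr laurent; apply: eq_bigr => -[i j] _ /=; rewrite monomD // mulrACA.
Qed.

Lemma laurent_monom r (z : 'I_r -> F) (a : 'cV[nat]_r) :
  (forall i, laurent C x (z i)) -> laurent C x (monom z (map_mx Posz a)).
Proof.
move=> Lz; apply: big_ind => [|z1 z2|i _]; [exact: laurent1|exact: laurentM|].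
rewrite mxE; elim: (a i ord0) => [|k IH]; first exact: laurent1.
by rewrite -exprnP exprS; apply: laurentM => //; apply: Lz.
Qed.

End LaurentRing.

Section Independence.
Variables (F : fieldType) (k : nat) (h : 'I_k -> F).
Hypothesis h_indep : alg_indep (intr : int -> F) h.

Lemma alg_indep_neq0 i : h i != 0.
Proof.
apply/eqP => hi0.
have /h_indep/(congr1 (mcoeff U_(i)))/eqP : mmap intr h 'X_i = 0.
  by rewrite mmapX mmap1U.
by rewrite mcoeffXU eqxx mcoeff0.
Qed.

Lemma monom_clear_denominators (s : seq 'cV[int]_k) :
  exists (d : 'cV[int]_k) (M : 'cV[int]_k -> 'X_{1..k}),
    forall a, a \in s -> a + d = \col_j (M a j)%:Z.
Proof.
pose d : 'cV[int]_k := \col_j (\sum_(a <- s) `|a j ord0|)%N%:Z.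
exists d, (fun a => [multinom `|((a + d) j ord0)%R|%N | j < k]) => a sa.
apply/matrixP => j l; rewrite !ord1 [RHS]mxE mnmE gez0_abs // !mxE.
rewrite (big_rem a) //= PoszD addrA addr_ge0 // abszE -lerBlDl sub0r -normrN.
exact: ler_norm.
Qed.

(** Multiplying by a monomial which clears all negative exponents turns the
    relation into an equality of polynomials, in which the coefficients of the
    shift of b can be compared. *)
Lemma laurent_coeff (I : finType) (c : I -> int) (w : I -> 'cV[int]_k) b :
  \sum_i (c i)%:~R * monom h (w i) = monom h b -> \sum_(i | w i == b) c i = 1.
Proof.
move=> e; have h0 := alg_indep_neq0.
pose s := b :: map w (enum I).
have [d [M Md]] := monom_clear_denominators s.
have evalM a : a \in s -> mmap intr h 'X_[M a] = monom h a * monom h d.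
  move=> /Md ad; rewrite mmapX -monomD // ad.
  by apply: eq_bigr => j _; rewrite mxE.
have bs : b \in s by rewrite inE eqxx.
have ws i : w i \in s by rewrite inE map_f ?orbT // mem_enum.
have Mb i : (M (w i) == M b) = (w i == b).
  apply/eqP/eqP => [eM|-> //]; apply: (addIr d).
  by rewrite !Md // eM.
have /h_indep/(congr1 (mcoeff (M b)))/eqP :
    mmap intr h (\sum_i c i *: 'X_[M (w i)] - 'X_[M b]) = 0.
  rewrite rmorphB rmorph_sum /= evalM // -e mulr_suml.
  apply/eqP; rewrite subr_eq0; apply/eqP/eq_bigr => i _.
  by rewrite mmapZ evalM // mulrA.
rewrite mcoeffB mcoeff0 raddf_sum /= subr_eq0 mcoeffX eqxx => /eqP.
apply: etrans; rewrite big_mkcond; apply: eq_bigr => i _ /=.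
by rewrite mcoeffZ mcoeffX Mb; case: eqP; rewrite ?mulr1 ?mulr0.
Qed.

(** The coefficients of the monomial b add up to 1, so one of them is
    positive. *)
Lemma laurent_pos_term (I : finType) (c : I -> int) (w : I -> 'cV[int]_k) b :
  \sum_i (c i)%:~R * monom h (w i) = monom h b ->
  exists2 i, w i = b & 0 < c i.
Proof.
move=> /laurent_coeff s1.
have /existsP[i /andP[/eqP wi ci]] : [exists i, (w i == b) && (0 < c i)].
  apply: contra_eqT s1; rewrite negb_exists => /forallP c_le0.
  rewrite lt_eqF // (@le_lt_trans _ _ 0) // sumr_le0 // => i wi.
  by have := c_le0 i; rewrite wi -leNgt.
by exists i.
Qed.

End Independence.

(** * Subtraction-free elements *)

Section NonnegativePolynomials.
Variable k : nat.

Definition nneg_mpoly (p : {mpoly int[k]}) : Prop := forall v, 0 <= p@_v.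

Implicit Types p q : {mpoly int[k]}.

Lemma nneg_mpoly0 : nneg_mpoly 0.
Proof. by move=> v; rewrite mcoeff0. Qed.

Lemma nneg_mpoly1 : nneg_mpoly 1.
Proof. by move=> v; rewrite mcoeff1; case: eqP. Qed.

Lemma nneg_mpolyX v : nneg_mpoly 'X_[v].
Proof. by move=> v'; rewrite mcoeffX; case: eqP. Qed.

Lemma nneg_mpolyD p q : nneg_mpoly p -> nneg_mpoly q -> nneg_mpoly (p + q).
Proof. by move=> pn qn v; rewrite mcoeffD addr_ge0. Qed.

Lemma nneg_mpolyM p q : nneg_mpoly p -> nneg_mpoly q -> nneg_mpoly (p * q).
Proof.
by move=> pn qn v; rewrite mcoeffM sumr_ge0 // => i _; apply: mulr_ge0.
Qed.

Lemma nneg_mpoly_addr_eq0 p q :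
  nneg_mpoly p -> nneg_mpoly q -> p + q = 0 -> p = 0.
Proof.
move=> pn qn pq; apply/mpolyP => v.
move/(congr1 (mcoeff v))/eqP: pq; rewrite mcoeffD !mcoeff0.
by rewrite paddr_eq0 // => /andP[/eqP].
Qed.

End NonnegativePolynomials.

Section SubtractionFree.
Variables (F : fieldType) (k : nat) (h : 'I_k -> F).
Hypothesis h_indep : alg_indep (intr : int -> F) h.

Local Notation phi := (mmap (intr : int -> F) h).

(** The elements which can be written from the family h with the help of +, *, /
    only: the universal semifield of Fomin and Zelevinsky, together with 0.
    Contrary to the positive Laurent polynomials in one given cluster, they are
    closed under inverses, which makes them comparable for different clusters. *)
Definition subtraction_free (z : F) : Prop :=
  exists p q : {mpoly int[k]},
    [/\ nneg_mpoly p, nneg_mpoly q, q != 0 & z = phi p / phi q].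

Lemma mmap_neq0 p : p != 0 -> phi p != 0.
Proof. by apply: contra_neq => /h_indep. Qed.

Lemma subtraction_free_eval p : nneg_mpoly p -> subtraction_free (phi p).
Proof.
move=> pn; exists p, 1; split=> //; [exact: nneg_mpoly1 | exact: oner_neq0 |].
by rewrite rmorph1 divr1.
Qed.

Lemma subtraction_free_gen i : subtraction_free (h i).
Proof.
have -> : h i = phi 'X_i by rewrite mmapX mmap1U.
exact/subtraction_free_eval/nneg_mpolyX.
Qed.

Lemma subtraction_freeD z z' :
  subtraction_free z -> subtraction_free z' -> subtraction_free (z + z').
Proof.
case=> p [q [pn qn q0 ->]] [p' [q' [pn' qn' q0' ->]]].
exists (p * q' + p' * q), (q * q').
split; [| exact: nneg_mpolyM | exact: mulf_neq0 |].
  by apply: nneg_mpolyD; apply: nneg_mpolyM.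
by rewrite addf_div ?mmap_neq0 // rmorphD !rmorphM.
Qed.

Lemma subtraction_freeM z z' :
  subtraction_free z -> subtraction_free z' -> subtraction_free (z * z').
Proof.
case=> p [q [pn qn q0 ->]] [p' [q' [pn' qn' q0' ->]]].
exists (p * p'), (q * q').
split; [exact: nneg_mpolyM | exact: nneg_mpolyM | exact: mulf_neq0 |].
by rewrite mulf_div !rmorphM.
Qed.

Lemma subtraction_freeV z : subtraction_free z -> subtraction_free z^-1.
Proof.
case=> p [q [pn qn q0 ->]]; rewrite invf_div.
have [->|p0] := eqVneq p 0; last by exists q, p.
rewrite rmorph0 invr0 mulr0 -(rmorph0 phi).
exact/subtraction_free_eval/nneg_mpoly0.
Qed.

Lemma subtraction_free_expz z (a : int) :
  subtraction_free z -> subtraction_free (z ^ a).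
Proof.
move=> fz; have fX (l : nat) : subtraction_free (z ^+ l).
  elim: l => [|l IH]; last by rewrite exprS; apply: subtraction_freeM.
  by rewrite expr0 -(rmorph1 phi); apply/subtraction_free_eval/nneg_mpoly1.
by case: a => l; [apply: fX | apply/subtraction_freeV/fX].
Qed.

Lemma subtraction_free_sum (I : Type) (r : seq I) (f : I -> F) :
  (forall i, subtraction_free (f i)) -> subtraction_free (\sum_(i <- r) f i).
Proof.
move=> ff; apply: big_ind => //; last exact: subtraction_freeD.
by rewrite -(rmorph0 phi); apply/subtraction_free_eval/nneg_mpoly0.
Qed.

Lemma subtraction_free_monom r (z : 'I_r -> F) a :
  (forall i, subtraction_free (z i)) -> subtraction_free (monom z a).
Proof.
move=> fz; apply: big_ind; last by move=> i _; apply: subtraction_free_expz.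
  by rewrite -(rmorph1 phi); apply/subtraction_free_eval/nneg_mpoly1.
exact: subtraction_freeM.
Qed.

(** If p / q + p' / q' = 0, then p q' + p' q = 0 by algebraic independence, and
    nonnegative coefficients cannot cancel. *)
Lemma subtraction_free_antisym z :
  subtraction_free z -> subtraction_free (- z) -> z = 0.
Proof.
case=> p [q [pn qn q0 ->]] [p' [q' [pn' qn' q0' /eqP]]].
rewrite eq_sym -addr_eq0 addrC addf_div ?mmap_neq0 // mulf_eq0 invr_eq0.
rewrite -!rmorphM -rmorphD (negPf (mmap_neq0 (mulf_neq0 q0 q0'))) orbF.
move/eqP/h_indep.
move/(nneg_mpoly_addr_eq0 (nneg_mpolyM pn qn') (nneg_mpolyM pn' qn))/eqP.
by rewrite mulf_eq0 (negPf q0') orbF => /eqP->; rewrite rmorph0 mul0r.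
Qed.

End SubtractionFree.

(** * Setting the coefficients to zero *)

Section Coefficients.
Variables (F : fieldType) (n m : nat) (x : 'I_n -> F) (y : 'I_m -> F).
Hypothesis xy_indep : alg_indep (intr : int -> F) (join_family x y).

Lemma join_familyl i : join_family x y (lshift m i) = x i.
Proof. by rewrite /join_family (unsplitK (inl i)). Qed.

Lemma join_familyr j : join_family x y (rshift n j) = y j.
Proof. by rewrite /join_family (unsplitK (inr j)). Qed.

Lemma join_family_neq0 i : x i != 0.
Proof. by rewrite -join_familyl; apply: (alg_indep_neq0 xy_indep). Qed.

(** Reduces the independence of Laurent monomials in x to that of Laurent
    monomials in the family x, y. *)
Lemma monom_join_family a : monom x a = monom (join_family x y) (col_mx a 0).
Proof.
rewrite [RHS]/monom big_split_ord /= [X in _ * X]big1 ?mulr1 => [|j _].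
  by apply: eq_bigr => i _; rewrite join_familyl col_mxEu.
by rewrite col_mxEd mxE.
Qed.

Lemma laurent_pos_term_join N (c : 'I_N -> int) (w : 'I_N -> 'cV[int]_n) b :
  \sum_i (c i)%:~R * monom x (w i) = monom x b ->
  exists2 i, w i = b & 0 < c i.
Proof.
rewrite (eq_bigr _ (fun i _ => congr1 _ (monom_join_family (w i)))).
rewrite monom_join_family => /(laurent_pos_term xy_indep)[i wi ci].
by exists i => //; case/eq_col_mx: wi.
Qed.

Definition y0_image (k : 'I_(n + m)) : {mpoly int[n + m]} :=
  match split k with inl _ => 'X_k | inr _ => 0 end.

Definition kill_y : {mpoly int[n + m]} -> {mpoly int[n + m]} :=
  mmap (@mpolyC (n + m) int) y0_image.

HB.instance Definition _ := GRing.RMorphism.copy kill_y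
  (mmap (@mpolyC (n + m) int) y0_image).

(** Here the residue field is embedded in F again, as the rational functions in
    x. *)
Definition at_y0 : F -> F -> Prop :=
  specializes (mmap (intr : int -> F) (join_family x y)) kill_y.

Lemma at_y0_x i : at_y0 (x i) (x i).
Proof.
have := specializes_eval (mmap intr (join_family x y)) kill_y 'X_(lshift m i).
rewrite /= /kill_y [in X in specializes _ _ _ X]mmapX mmap1U.
by rewrite /y0_image (unsplitK (inl i)) mmapX mmap1U join_familyl.
Qed.

Lemma at_y0_y j : at_y0 (y j) 0.
Proof.
have := specializes_eval (mmap intr (join_family x y)) kill_y 'X_(rshift n j).
rewrite /= /kill_y [in X in specializes _ _ _ X]mmapX mmap1U.
by rewrite /y0_image (unsplitK (inr j)) rmorph0 mmapX mmap1U join_familyr.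
Qed.

Lemma at_y0_prod_y (v : 'X_{1..m}) :
  at_y0 (\prod_(j < m) y j ^+ v j) (v == 0%MM)%:R.
Proof.
have -> : (v == 0%MM)%:R = \prod_(j < m) (0 ^+ v j : F).
  have [->|v0] := eqVneq v 0%MM; first by rewrite big1 // => j _; rewrite mnm0E.
  have [j vj] : exists j, v j != 0.
    apply/existsP; apply: contraNT v0; rewrite negb_exists => /forallP v0.
    by apply/eqP/mnmP => j; rewrite mnm0E; apply/eqP; rewrite -[_ == _]negbK.
  by rewrite (bigD1 j) //= expr0n (negPf vj) mul0r.
apply: specializes_prod => // j; apply: specializesX => //; exact: at_y0_y.
Qed.

Lemma at_y0_polyZ (p : {mpoly int[m]}) : at_y0 (mmap intr y p) (p@_0%MM)%:~R.
Proof.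
have -> : (p@_0%MM)%:~R = \sum_(v <- msupp p) (p@_v)%:~R * (v == 0%MM)%:R :> F.
  transitivity ((\sum_(v <- msupp p) p@_v * (v == 0%MM)%:R)%:~R : F).
    congr intr; rewrite {1}[p]mpolyE raddf_sum /=.
    by apply: eq_bigr => v _; rewrite mcoeffZ mcoeffX.
  by rewrite rmorph_sum /=; apply: eq_bigr => v _; rewrite rmorphM /=; case: eqP.
apply: specializes_sum => // v; apply: specializesM => //.
  exact: specializes_int.
exact: at_y0_prod_y.
Qed.

(** The reason why g-vectors are visible at y = 0: each term other than the
    leading one is divisible by some y_j. *)
Lemma at_y0_gvector z g : has_gvector x y z g -> at_y0 z (monom x g).
Proof.
case=> N [c [v [u [v0 ->]]]].
have x0 := join_family_neq0.
have xx (a : 'cV[int]_n) : at_y0 (monom x a) (monom x a).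
  by apply: specializes_monom => // i; apply: at_y0_x.
have h0 : at_y0 (\sum_(k < N) (c k)%:~R * (\prod_(j < m) y j ^+ v k j)
                               * monom x (u k)) 0.
  have e0 : \sum_(k < N) (c k)%:~R * (v k == 0%MM)%:R * monom x (u k) = 0 :> F.
    by rewrite big1 // => k _; rewrite (negPf (v0 k)) mulr0 mul0r.
  rewrite -[X in at_y0 _ X]e0; apply: specializes_sum => // k.
  apply: specializesM (xx _).
  by apply: specializesM; [exact: specializes_int|exact: at_y0_prod_y].
have := specializesD xy_indep (specializes_nat _ _ 1) h0.
by rewrite addr0 => /(specializesM (xx g)); rewrite mulr1.
Qed.

Lemma at_y0_Gmonom (z : 'I_n -> F) (G : 'M[int]_n) (a : 'cV[int]_n) :
  (forall i, has_gvector x y (z i) (col i G)) ->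
  at_y0 (monom z a) (monom x (G *m a)).
Proof.
move=> zG; rewrite -monom_mulmx; last exact: join_family_neq0.
apply: specializes_monom => // i; last exact: at_y0_gvector.
by apply: monom_neq0; exact: join_family_neq0.
Qed.

(** At y = 0, the expansion of f has some term with exponent b and a positive
    coefficient.  This term comes from a monomial u of the expansion whose
    coefficient has a positive constant term, from which 1 can be removed
    without making it negative. *)
Lemma leading_term_split (z : 'I_n -> F) (G : 'M[int]_n) f b :
  (forall i, has_gvector x y (z i) (col i G)) ->
  laurent (polyZ_nneg y) z f -> at_y0 f (monom x b) ->
  exists2 u, G *m u = b & laurent (polyZ_nneg y) z (f - monom z u).
Proof.
move=> zG [N [c [u [/fin_all_exists[p /all_and2[pn cp]] ->]]]] fb.
have f_y0 : at_y0 (\sum_(k < N) c k * monom z (u k))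
                  (\sum_(k < N) ((p k)@_0%MM)%:~R * monom x (G *m u k)).
  apply: specializes_sum => // k; apply: specializesM => //.
    by rewrite cp; apply: at_y0_polyZ.
  exact: at_y0_Gmonom.
have [k0 Gu pk0] := laurent_pos_term_join (specializes_fun xy_indep f_y0 fb).
exists (u k0) => //.
exists N, (fun k => if k == k0 then mmap intr y (p k - 1) else c k), u.
split=> [k|].
  case: eqP => [->|_]; last by exists (p k).
  (* only the constant term drops, and it was positive *)
  exists (p k0 - 1); split=> // v; rewrite mcoeffB mcoeff1.
  by case: eqP => [->|_]; rewrite ?subr0 // subr_ge0 -gtz0_ge1.
rewrite (bigD1 k0) //= [RHS](bigD1 k0) //= eqxx rmorphB rmorph1 /= -cp.
rewrite mulrBl mul1r addrAC; congr (_ + _).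
by apply: eq_bigr => k /negPf->.
Qed.

Lemma subtraction_free_laurent r (z : 'I_r -> F) f :
  (forall i, subtraction_free (join_family x y) (z i)) ->
  laurent (polyZ_nneg y) z f -> subtraction_free (join_family x y) f.
Proof.
move=> zf [N [c [u [cC ->]]]]; apply: subtraction_free_sum => // k.
apply: subtraction_freeM => //; last exact: subtraction_free_monom.
case: (cC k) => p [pn ->]; rewrite /mmap; apply: subtraction_free_sum => // v.
apply: subtraction_freeM => //.
  have -> : intr p@_v = mmap intr (join_family x y) (p@_v)%:MP by rewrite mmapC.
  apply: subtraction_free_eval => v'.
  by rewrite mcoeffC mulr_ge0 ?pn //; case: eqP.
apply: big_ind => [|a b|j _].
- rewrite -(rmorph1 (mmap intr (join_family x y))).
  exact/subtraction_free_eval/nneg_mpoly1.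
- exact: subtraction_freeM.
rewrite exprnP; apply: subtraction_free_expz => //.
by rewrite -join_familyr; apply: subtraction_free_gen.
Qed.

End Coefficients.

Lemma polyZ_nneg1 (F : fieldType) m (y : 'I_m -> F) : polyZ_nneg y 1.
Proof. by exists 1; split; [exact: nneg_mpoly1 | rewrite rmorph1]. Qed.

Lemma polyZ_nnegM (F : fieldType) m (y : 'I_m -> F) a b :
  polyZ_nneg y a -> polyZ_nneg y b -> polyZ_nneg y (a * b).
Proof.
case=> p [pn ->] [q [qn ->]]; exists (p * q).
by rewrite rmorphM; split=> //; apply: nneg_mpolyM.
Qed.

Lemma unimodular_is_Zbasis n (G U : 'M[int]_n) :
  G *m U = 1%:M -> is_Zbasis (fun i => col i G).
Proof.
move=> GU; have UG := mulmx1C GU.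
have combE (c : 'I_n -> int) : \sum_i c i *: col i G = G *m \col_i c i.
  apply/matrixP => i k; rewrite !mxE summxE.
  by apply: eq_bigr => j _; rewrite !mxE mulrC.
split=> [c|v].
  rewrite combE => /(congr1 (mulmx U)); rewrite mulmxA UG mul1mx mulmx0.
  by move/matrixP=> c0 i; have := c0 i 0; rewrite !mxE.
exists (fun i => (U *m v) i 0); rewrite combE.
rewrite (_ : \col_i _ = U *m v) ?mulmxA ?GU ?mul1mx //.
by apply/matrixP => i k; rewrite !ord1 mxE.
Qed.

(** * Cluster monomials *)

Section PositivePointed.
Variables (A : idomainType) (n : nat) (T : Type) (x : T -> 'I_n -> ratfun A n).
Variables (m : nat) (y : 'I_m -> ratfun A n).
Hypothesis xy_indep : forall t,
  alg_indep (intr : int -> ratfun A n) (join_family (x t) y).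
Hypothesis x_positive : positive x y.
Variables (t0 : T) (G : T -> 'M[int]_n).
Hypothesis G_Gmatrix : forall t, is_Gmatrix x y t0 t (G t).

(** The columns of U are the exponents of the leading terms of the x_{j;t0}
    expanded in x_t, for which the exponent of the value at y = 0 is the j-th
    unit vector. *)
Lemma Gmatrix_right_inverse t : exists U, G t *m U = 1%:M.
Proof.
have xj j : exists u : 'cV_n, G t *m u = delta_mx j 0.
  have [|u Gu _] := leading_term_split (@xy_indep t0) (G_Gmatrix t)
    (b := delta_mx j 0) (x_positive t t0 j).
    rewrite monom_delta; exact: at_y0_x.
  by exists u.
have [u Gu] := fin_all_exists xj.
exists (\matrix_(i, j) u j i 0); apply/matrixP => i j.
have /matrixP/(_ i 0) := Gu j; rewrite !mxE eqxx andbT => <-.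
by apply: eq_bigr => k _; rewrite mxE.
Qed.

(** The leading term of x_t^a expanded in x_{t'} must be x_{t'}^{a'}, as G_{t'}
    is injective; the remainder is a positive Laurent polynomial in x_{t'}, and
    the entries of x_{t'} are subtraction-free in x_{t0} and y. *)
Lemma cluster_monomial_diff_subtraction_free t t' (a a' : 'cV[nat]_n) :
  G t *m map_mx Posz a = G t' *m map_mx Posz a' ->
  subtraction_free (join_family (x t0) y)
    (cluster_monomial x t a - cluster_monomial x t' a').
Proof.
move=> Gaa'; have [U /mulmx1C UG] := Gmatrix_right_inverse t'.
have La : laurent (polyZ_nneg y) (x t') (cluster_monomial x t a).
  have x0' := join_family_neq0 (@xy_indep t').
  have yM := @polyZ_nnegM _ _ y.
  by apply: (laurent_monom x0' (polyZ_nneg1 y) yM) => i; apply: x_positive.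
have [|u Gu] := leading_term_split (@xy_indep t0) (G_Gmatrix t') La
    (b := G t *m map_mx Posz a).
  by apply: (at_y0_Gmonom (@xy_indep t0)); apply: G_Gmatrix.
have -> : u = map_mx Posz a'.
  by rewrite -[u]mul1mx -UG -mulmxA Gu Gaa' mulmxA UG mul1mx.
apply: subtraction_free_laurent => // i.
apply: subtraction_free_laurent (x_positive t0 t' i) => // j.
by rewrite -(join_familyl (x t0) y); apply: subtraction_free_gen.
Qed.

End PositivePointed.

Theorem corollary5p7
  (P : groupType) (P_abelian : forall p q : P, (p * q)%g = (q * p)%g)
  (ZP : idomainType) (e : P -> ZP) (ZP_group_ring : is_group_ring e)
  (n : nat) (T : Type) (x : T -> 'I_n -> ratfun ZP n)
  (x_GLP : GLP_pattern x)
  (m : nat) (yP : 'I_m -> P)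
  (y := (fun j => ground_ratfun n (e (yP j))) : 'I_m -> ratfun ZP n)
  (xy_indep : forall t,
     alg_indep (intr : int -> ratfun ZP n) (join_family (x t) y))
  (t0 : T) (x_pointed : pointed x y t0) (x_positive : positive x y)
  (G : T -> 'M[int]_n) (G_Gmatrix : forall t, is_Gmatrix x y t0 t (G t)) :
  (forall (t t' : T) (a a' : 'cV[nat]_n),
     cluster_monomial x t a <> cluster_monomial x t' a' ->
     G t *m map_mx Posz a <> G t' *m map_mx Posz a') /\
  (forall t : T, is_Zbasis (fun i => col i (G t))).
Proof.
split=> [t t' a a' ne_aa' Gaa'|t]; last first.
  have [U] := Gmatrix_right_inverse xy_indep x_positive G_Gmatrix t.
  exact: unimodular_is_Zbasis.
apply/ne_aa'/eqP; rewrite -subr_eq0; apply/eqP.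
apply: (subtraction_free_antisym (@xy_indep t0)); rewrite ?opprB;
  exact: cluster_monomial_diff_subtraction_free.
Qed.
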